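(* For every $n\ge 1$ and every Boolean function $f\colon\{-1,1\}^n\to\{-1,1\}$, $$\mathbb{H}(\hat f^2)\;\le\; 2\cdot \mathsf{aUC}^{\oplus}(f),$$ where $\mathbb{H}(\hat f^2)$ is the Fourier entropy of $f$ and $\mathsf{aUC}^{\oplus}(f)$ is the average unambiguous parity-certificate complexity of $f$.
   Context: All logarithms are base 2. For $g\colon\{-1,1\}^n\to\mathbb{R}$ and $S\subseteq[n]$, $\hat g(S)=\mathbb{E}_x[g(x)\prod_{i\in S}x_i]$ with $x$ uniform in $\{-1,1\}^n$. For Boolean $f\colon\{-1,1\}^n\to\{-1,1\}$ we have $\sum_S\hat f(S)^2=1$, and the Fourier entropy is $\mathbb{H}(\hat f^2)=\sum_{S\subseteq[n]}\hat f(S)^2\log\frac{1}{\hat f(S)^2}$ (with $0\log\frac10=0$). Identify $\{-1,1\}^n$ with $\mathbb{F}_2^n$ via $-1\leftrightarrow 1$, $1\leftrightarrow 0$ coordinatewise. An affine subspace of $\{-1,1\}^n$ of co-dimension $k$ is then a (nonempty) set of the form $\{x:\prod_{i\in S_j}x_i=b_j,\ j=1,\dots,k\}$ with $b_j\in\{-1,1\}$ and $S_1,\dots,S_k\subseteq[n]$ whose indicator vectors are linearly independent over $\mathbb{F}_2$. An unambiguous $\oplus$-certificate for $f$ is a collection $\mathcal{U}=\{C_1,\dots,C_m\}$ of pairwise disjoint affine subspaces covering $\{-1,1\}^n$ such that $f$ is constant on each $C_i$. For $x\in\{-1,1\}^n$, $\mathsf{UC}^\oplus(\mathcal{U},x)$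 is the co-dimension of the unique $C_i\in\mathcal U$ containing $x$. Define $\mathsf{aUC}^\oplus(f,\mathcal{U})=\mathbb{E}_x[\mathsf{UC}^\oplus(\mathcal{U},x)]$ ($x$ uniform) and $\mathsf{aUC}^\oplus(f)=\min_{\mathcal{U}}\mathsf{aUC}^\oplus(f,\mathcal{U})$ over all unambiguous $\oplus$-certificates for $f$. *)

(* Defs.v *)
From HB Require Import structures.
From mathcomp Require Import all_boot all_order all_algebra.
From mathcomp Require Import reals exp.

Set Implicit Arguments.
Unset Strict Implicit.
Unset Printing Implicit Defensive.
Import Order.TTheory GRing.Theory Num.Theory.
Local Open Scope ring_scope.

(* The sign -1 is encoded by [true] and the sign 1 by [false], which is also
   the identification with F_2; the sign of b : bool is (-1) ^+ b. *)
Notation cube n := {ffun 'I_n -> bool}.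

Definition chi (R : pzRingType) n (S : {set 'I_n}) (x : cube n) : R :=
  \prod_(i in S) (-1) ^+ x i.

Definition cube_mean (R : realType) n (g : cube n -> R) : R :=
  (\sum_x g x) / #|cube n|%:R.

Definition fourier (R : realType) n (g : cube n -> R) (S : {set 'I_n}) : R :=
  cube_mean (fun x => g x * chi R S x).

Definition log2 (R : realType) (x : R) : R := ln x / ln 2.

(* In a term with a zero coefficient the factor [log2 (1 / 0)] is some real
   number, so that the convention 0 log (1/0) = 0 holds. *)
Definition fourier_entropy (R : realType) n (f : cube n -> R) : R :=
  \sum_(S : {set 'I_n}) fourier f S ^+ 2 * log2 (1 / fourier f S ^+ 2).

Definition indicator_mx n k (S : 'I_k -> {set 'I_n}) : 'M['F_2]_(k, n) :=
  \matrix_(j, i) (i \in S j)%:R.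

Definition affine_codim n (k : nat) (C : {set cube n}) : bool :=
  (C != set0) &&
  [exists S : {ffun 'I_k -> {set 'I_n}}, exists b : {ffun 'I_k -> bool},
     row_free (indicator_mx S) &&
     (C == [set x | [forall j, chi int (S j) x == (-1) ^+ b j]])].

(* The bound k <= n is automatic; see [affine_codim_leq]. *)
Definition affine_subspace n (C : {set cube n}) : bool :=
  [exists k : 'I_n.+1, affine_codim k C].

(* The k is unique, see [affine_codim_inj]; the default value 0 is only
   used when C is not an affine subspace. *)
Definition codim n (C : {set cube n}) : nat :=
  odflt ord0 [pick k : 'I_n.+1 | affine_codim k C].

Definition parity_certificate (R : realType) n (f : cube n -> R)
    (U : {set {set cube n}}) : bool :=
  partition U [set: cube n] &&
  [forall C in U, affine_subspace C &&
     [forall x in C, forall y in C, f x == f y]].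

Definition UC n (U : {set {set cube n}}) (x : cube n) : nat :=
  codim (pblock U x).

Definition aUC_of (R : realType) n (U : {set {set cube n}}) : R :=
  cube_mean (fun x => (UC U x)%:R).

Definition singletons n : {set {set cube n}} := [set [set x] | x : cube n].

(* [singletons n] only witnesses that the minimum ranges over a nonempty
   set; see [singletons_certificate] and [aUC_min]. *)
Definition aUC (R : realType) n (f : cube n -> R) : R :=
  aUC_of R [arg min_(U < singletons n | parity_certificate f U) aUC_of R U]%O.

Lemma affine_codim_set1 n (x : cube n) : affine_codim n [set x].
Proof.
apply/andP; split; first by apply/set0Pn; exists x; rewrite inE.
apply/existsP; exists [ffun i => [set i]]; apply/existsP; exists x.
apply/andP; split.
  rewrite (_ : indicator_mx _ = 1%:M) ?row_free_unit ?unitmx1 //.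
  by apply/matrixP => j i; rewrite !mxE ffunE inE eq_sym.
apply/eqP/setP => y; rewrite !inE; apply/eqP/forallP => [-> j|yx].
  by rewrite ffunE /chi big_set1.
apply/ffunP => j; move: (yx j); rewrite ffunE /chi big_set1.
by case: (y j); case: (x j).
Qed.

Lemma singletons_certificate (R : realType) n (f : cube n -> R) :
  parity_certificate f (singletons n).
Proof.
apply/andP; split.
  apply/and3P; split.
  - apply/eqP/setP => x; rewrite inE; apply/bigcupP.
    by exists [set x]; rewrite ?inE // imset_f.
  - apply/trivIsetP => _ _ /imsetP[x _ ->] /imsetP[y _ ->] xy.
    by rewrite disjoints1 inE; apply: contraNneq xy => ->.
  - by apply/imsetP => -[x _] /setP /(_ x); rewrite !inE eqxx.
apply/forall_inP => _ /imsetP[x _ ->]; apply/andP; split.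
  by apply/existsP; exists ord_max; exact: affine_codim_set1.
by apply/forall_inP => y /set1P ->; apply/forall_inP => z /set1P ->.
Qed.

Lemma aUC_min (R : realType) n (f : cube n -> R) :
  (exists2 U, parity_certificate f U & aUC f = aUC_of R U) /\
  (forall U, parity_certificate f U -> aUC f <= aUC_of R U).
Proof.
rewrite /aUC; case: arg_minP => [|U fU minU]; first exact: singletons_certificate.
by split; first exists U.
Qed.

Lemma chiXOR n (S : {set 'I_n}) (x v : cube n) :
  chi int S [ffun i => x i (+) v i] = chi int S x * chi int S v.
Proof. by rewrite /chi -big_split; apply: eq_bigr => i _; rewrite ffunE signr_addb. Qed.

Lemma chi_indicator_mx n k (S : 'I_k -> {set 'I_n}) (v : 'rV['F_2]_n) :
  (v *m (indicator_mx S)^T == 0) =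
  [forall j, chi int (S j) [ffun i => v 0 i != 0] == 1].
Proof.
have F2 (a : 'F_2) : a = (a != 0)%:R by case: a => -[|[|[]]] // i; apply/val_inj.
have F2n (m : nat) : (m%:R == 0 :> 'F_2) = ~~ odd m.
  by rewrite -(dvdn_pcharf (pchar_Fp (isT : prime 2))) dvdn2.
apply/eqP/forallP => [v0 j|v0].
  move/rowP/(_ j): v0; rewrite !mxE => v0.
  rewrite /chi prodrXr -signr_odd.
  suff -> : odd (\sum_(i in S j) [ffun i => (v 0 i != 0)%R] i) = false by [].
  apply/negbTE; rewrite -F2n natr_sum -[X in _ == X]v0 big_mkcond; apply/eqP.
  apply: eq_bigr => i _; rewrite !mxE ffunE.
  by case: ifP => _; rewrite ?mulr1 ?mulr0 // -F2.
apply/rowP => j; move/eqP: (v0 j); rewrite !mxE /chi prodrXr -signr_odd => v1.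
have: ~~ odd (\sum_(i in S j) [ffun i => (v 0 i != 0)%R] i) by move: v1; case: odd.
rewrite -F2n natr_sum => /eqP s0; rewrite -[RHS]s0 [RHS]big_mkcond.
apply: eq_bigr => i _; rewrite !mxE ffunE.
by case: ifP => _; rewrite ?mulr1 ?mulr0 // -F2.
Qed.

Lemma affine_codim_inj n k l (C : {set cube n}) :
  affine_codim k C -> affine_codim l C -> k = l.
Proof.
case/andP => /set0Pn[x Cx] /existsP[S /existsP[b /andP[freeS /eqP CS]]].
case/andP => _ /existsP[T /existsP[c /andP[freeT /eqP CT]]].
have ker m (Q : 'I_m -> {set 'I_n}) (d : 'I_m -> bool) (v : 'rV['F_2]_n) :
    C = [set y | [forall j, chi int (Q j) y == (-1) ^+ d j]] ->
    (v *m (indicator_mx Q)^T == 0) =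
    ([ffun i => x i (+) [ffun i => v 0 i != 0] i] \in C).
  move=> CQ; rewrite chi_indicator_mx CQ inE; apply: eq_forallb => j.
  move: Cx; rewrite CQ inE => /forallP/(_ j)/eqP xd.
  by rewrite chiXOR xd -[X in _ = (_ == X)]mulr1 (inj_eq (mulfI _)) ?signr_eq0.
have kerE : (kermx (indicator_mx S)^T == kermx (indicator_mx T)^T)%MS.
  apply/andP; split; apply/rV_subP => v /sub_kermxP/eqP v0;
    apply/sub_kermxP/eqP; move: v0.
    by rewrite (ker _ _ _ _ CS) (ker _ _ _ _ CT).
  by rewrite (ker _ _ _ _ CS) (ker _ _ _ _ CT).
have rk := eqmx_rank kerE; move: rk; rewrite !mxrank_ker !mxrank_tr.
move: (rank_leq_col (indicator_mx S)) (rank_leq_col (indicator_mx T)).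
move: freeS freeT; rewrite /row_free => /eqP -> /eqP -> kn ln e.
by rewrite -(subKn kn) e subKn.
Qed.

Lemma affine_codim_leq n k (C : {set cube n}) : affine_codim k C -> (k <= n)%N.
Proof.
case/andP => _ /existsP[S /existsP[_ /andP[/eqP rkS _]]].
by rewrite -rkS rank_leq_col.
Qed.

Lemma codimE n k (C : {set cube n}) : affine_codim k C -> codim C = k.
Proof.
move=> Ck; rewrite /codim; case: pickP => [l /affine_codim_inj/(_ Ck) //|/= noC].
by have := noC (inord k); rewrite inordK ?Ck // ltnS (affine_codim_leq Ck).
Qed.

(* Main.v *)
(* Write f as the sum of f_i = f * 1_(C_i) over the blocks C_i of a certificate,
   and p_i = |C_i| / 2^n.  The transforms of the f_i are orthogonal with squared
   norms p_i, and each of them has l1-norm 1, because the Fourier coefficients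
   of f_i are all 0 or +- p_i.  Moreover p_i >= 2^(- codim C_i), so it suffices
   to bound the entropy of the squares of F = sum_i a_i by twice the entropy of
   p, for any family a of orthogonal vectors with l1-norms at most 1.
   This data is stable under tensor powers.  In a high power, the weak law of
   large numbers confines p to indices with p_i >= exp(-N(h + d)), of which there
   are at most exp(N(h + d)), so that their a_i sum to a vector of l1-norm
   at most exp(N(h + d)); it also confines F^2 to coordinates where
   |F| <= exp(-N(e - d)).  Pairing the two shows that F^2 can have total mass 1
   only if e <= h. *)
Require Import Defs.
From mathcomp Require Import all_boot all_order all_algebra.
From mathcomp Require Import reals exp.
From mathcomp Require Import sequences ring lra.
Import Order.TTheory GRing.Theory Num.Theory.
Local Open Scope ring_scope.

Set Implicit Arguments.
Unset Strict Implicit.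
Unset Printing Implicit Defensive.

(** * Sums over products and second moments *)

Lemma sum_pair_mul (R : pzSemiRingType) (I J : finType) (g : I -> R) (h : J -> R) :
  \sum_(u : I * J) g u.1 * h u.2 = (\sum_i g i) * (\sum_j h j).
Proof. by rewrite big_distrlr /= pair_bigA. Qed.

Lemma chebyshev (R : realFieldType) (I : finType) (p Y : I -> R) (D : R) :
  (forall i, 0 <= p i) -> 0 < D ->
  \sum_(i | D < `|Y i|) p i <= (\sum_i p i * Y i ^+ 2) / D ^+ 2.
Proof.
move=> p0 D0; rewrite ler_pdivlMr ?exprn_gt0 // mulr_suml big_mkcond /=.
apply: ler_sum => i _; case: ifP => [DY|_]; last by rewrite mulr_ge0 ?sqr_ge0.
apply: ler_wpM2l => //; rewrite -(real_normK (num_real (Y i))).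
by rewrite ler_sqr ?nnegrE ?normr_ge0 ?ltW.
Qed.

(** Additivity of variance for independent variables: the cross term factors through a mean, which
    is 0. It serves both for [p] on indices and for the squares of F on coordinates. *)
Lemma centered_pair (R : comNzRingType) (I J : finType) (p X : I -> R) (q Y : J -> R) :
  \sum_i p i = 1 -> \sum_j q j = 1 ->
  \sum_i p i * X i = 0 -> \sum_j q j * Y j = 0 ->
  \sum_(u : I * J) (p u.1 * q u.2) * (X u.1 + Y u.2) = 0 /\
  \sum_(u : I * J) (p u.1 * q u.2) * (X u.1 + Y u.2) ^+ 2 =
    \sum_i p i * X i ^+ 2 + \sum_j q j * Y j ^+ 2.
Proof.
move=> p1 q1 pX qY; split.
  transitivity (\sum_(u : I * J) ((p u.1 * X u.1) * q u.2 + p u.1 * (q u.2 * Y u.2))).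
    by apply: eq_bigr => u _; ring.
  rewrite big_split /= (sum_pair_mul (fun i => p i * X i) q).
  by rewrite (sum_pair_mul p (fun j => q j * Y j)) pX qY mul0r mulr0 addr0.
transitivity (\sum_(u : I * J) ((p u.1 * X u.1 ^+ 2) * q u.2 +
   p u.1 * (q u.2 * Y u.2 ^+ 2) + (p u.1 * X u.1 *+ 2) * (q u.2 * Y u.2))).
  by apply: eq_bigr => u _; ring.
rewrite !big_split /= (sum_pair_mul (fun i => p i * X i ^+ 2) q).
rewrite (sum_pair_mul p (fun j => q j * Y j ^+ 2)).
rewrite (sum_pair_mul (fun i => p i * X i *+ 2) (fun j => q j * Y j)).
by rewrite p1 q1 qY mulr1 mul1r mulr0 addr0.
Qed.

(* h and e stand for sum_i p_i ln (1 / p_i) and sum_t F_t^2 ln (1 / |F_t|), where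
   F_t = sum_i a_i t; X and Z are the centered log-likelihoods, with variances
   v and w. *)
Record split_unit (R : realType) (I T : finType) (a : I -> T -> R) (p X : I -> R)
    (Z : T -> R) (h e v w : R) : Prop := SplitUnit {
  split_gram : forall i j, \sum_t a i t * a j t = (i == j)%:R * p i;
  split_mass : \sum_i p i = 1;
  split_l1 : forall i, \sum_t `|a i t| <= 1;
  split_lower : forall i, expR (- (h + X i)) <= p i;
  split_upper : forall t, `|\sum_i a i t| <= expR (- (e + Z t));
  split_X0 : \sum_i p i * X i = 0;
  split_X2 : \sum_i p i * X i ^+ 2 = v;
  split_Z0 : \sum_t (\sum_i a i t) ^+ 2 * Z t = 0;
  split_Z2 : \sum_t (\sum_i a i t) ^+ 2 * Z t ^+ 2 = w }.

(** * Truncation to typical indices and typical coordinates *)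

Section SplitUnit.
Variables (R : realType) (I T : finType) (a : I -> T -> R) (p X : I -> R).
Variables (Z : T -> R) (h e v w : R).
Hypothesis sp : split_unit a p X Z h e v w.

(** Pythagoras. For all indices it gives F norm 1; for the atypical ones it bounds the discarded
    vector by their mass under [p]. *)
Lemma split_sum_sqr (A : pred I) :
  \sum_t (\sum_(i | A i) a i t) ^+ 2 = \sum_(i | A i) p i.
Proof.
under eq_bigr => t _ do rewrite expr2 big_distrlr /=.
rewrite exchange_big /=; apply: eq_bigr => i Ai.
rewrite exchange_big /= (bigD1 i) //= (split_gram sp) eqxx mul1r.
rewrite big1 ?addr0 // => j /andP[_ ji].
by rewrite (split_gram sp) eq_sym (negbTE ji) mul0r.
Qed.

Lemma split_p_ge0 i : 0 <= p i.
Proof. exact: le_trans (expR_ge0 _) (split_lower sp i). Qed.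

(** The squares of F have total mass 1. Chebyshev controls the atypical parts, the typical pairing
    gives the exponential, and AM-GM costs the 1/4 missing from the left side. *)
Lemma split_deviation (D : R) : 0 < D ->
  3 / 4 <= (v + w) / D ^+ 2 + expR (D *+ 2 - (e - h)).
Proof.
move=> D0; pose F t := \sum_i a i t.
pose A := [pred i | `|X i| <= D]; pose B := [pred t | `|Z t| <= D].
pose g t := \sum_(i | A i) a i t; pose r t := \sum_(i | ~~ A i) a i t.
have FE t : F t = g t + r t by rewrite /F (bigID A).
have F1 : \sum_t F t ^+ 2 = 1 by rewrite (split_sum_sqr predT) (split_mass sp).
have notB : \sum_(t | ~~ B t) F t ^+ 2 <= w / D ^+ 2.
  rewrite -(split_Z2 sp); under eq_bigl => t do rewrite -ltNge.
  by apply: chebyshev => // t; exact: sqr_ge0.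
have r2 : \sum_t r t ^+ 2 <= v / D ^+ 2.
  rewrite split_sum_sqr -(split_X2 sp); under eq_bigl => i do rewrite -ltNge.
  by apply: chebyshev => //; exact: split_p_ge0.
(* Counting: every index in [A] carries mass at least [expR (- (h + D))], out of a total of 1. *)
have cardA : (\sum_(i | A i) 1) * expR (- (h + D)) <= 1.
  rewrite mulr_suml -[leRHS](split_mass sp) big_mkcond /=; apply: ler_sum => i _.
  case: ifP => [Ai|_]; last exact: split_p_ge0.
  rewrite mul1r; apply: le_trans (split_lower sp i).
  by rewrite ler_expR lerN2 lerD2l; apply: le_trans Ai; exact: ler_norm.
have gl1 : \sum_t `|g t| <= expR (h + D).
  apply: (@le_trans _ _ (\sum_(i | A i) 1)).
    apply: (@le_trans _ _ (\sum_t \sum_(i | A i) `|a i t|)).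
      by apply: ler_sum => t _; exact: ler_norm_sum.
    by rewrite exchange_big /=; apply: ler_sum => i _; exact: split_l1 sp i.
  by rewrite -(ler_pM2r (expR_gt0 (- (h + D)))) -expRD subrr expR0.
(* Hoelder: the bound on |F| over [B] times the l1-norm of [g]. *)
have Fg : \sum_(t | B t) F t * g t <= expR (D *+ 2 - (e - h)).
  have -> : D *+ 2 - (e - h) = - (e - D) + (h + D) by ring.
  rewrite expRD; apply: (@le_trans _ _ (\sum_t expR (- (e - D)) * `|g t|)).
    rewrite big_mkcond /=; apply: ler_sum => t _; case: ifP => [Bt|_]; last first.
      by rewrite mulr_ge0 ?expR_ge0.
    apply: le_trans (ler_norm _) _; rewrite normrM ler_wpM2r //.
    apply: le_trans (split_upper sp t) _; rewrite ler_expR lerN2 lerD2l.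
    by move: Bt; rewrite /= ler_norml => /andP[].
  by rewrite -mulr_sumr ler_wpM2l ?expR_ge0.
(* AM-GM: [F r <= F^2 / 4 + r^2] *)
have Fr : \sum_(t | B t) F t * r t <= 1 / 4 + \sum_t r t ^+ 2.
  rewrite -[X in X / 4]F1 mulr_suml -big_split /= big_mkcond /=; apply: ler_sum => t _.
  case: ifP => [_|_]; last by rewrite addr_ge0 ?divr_ge0 ?sqr_ge0.
  rewrite -subr_ge0 (_ : _ - _ = (F t / 2 - r t) ^+ 2) ?sqr_ge0 //; by field.
have : 1 = \sum_(t | B t) F t * g t + \sum_(t | B t) F t * r t +
           \sum_(t | ~~ B t) F t ^+ 2.
  rewrite -big_split /= -[LHS]F1 (bigID B) /=; congr (_ + _); apply: eq_bigr => t _.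
  by rewrite -mulrDr -FE.
rewrite mulrDl; move: notB r2 Fg Fr; clear; lra.
Qed.

End SplitUnit.

(** * Tensor powers and the limiting argument *)

Section Tensor.
Variables (R : realType) (I T J V : finType).
Variables (a : I -> T -> R) (p X : I -> R) (Z : T -> R) (h e v w : R).
Variables (b : J -> V -> R) (q Y : J -> R) (W : V -> R) (h' e' v' w' : R).

(** Gram entries, masses and l1-norms multiply over a product, exponents add, and variances add by
    [centered_pair]. *)
Lemma split_tensor :
  split_unit a p X Z h e v w -> split_unit b q Y W h' e' v' w' ->
  split_unit (fun (i : I * J) (t : T * V) => a i.1 t.1 * b i.2 t.2)
    (fun i => p i.1 * q i.2) (fun i => X i.1 + Y i.2) (fun t => Z t.1 + W t.2)
    (h + h') (e + e') (v + v') (w + w').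
Proof.
move=> sp sq.
have FE (t : T * V) : \sum_(i : I * J) a i.1 t.1 * b i.2 t.2 =
    (\sum_i a i t.1) * (\sum_j b j t.2).
  exact: (sum_pair_mul (a^~ t.1) (b^~ t.2)).
have F2 (s : T * V -> R) :
    \sum_t (\sum_(i : I * J) a i.1 t.1 * b i.2 t.2) ^+ 2 * s t =
    \sum_t ((\sum_i a i t.1) ^+ 2 * (\sum_j b j t.2) ^+ 2) * s t.
  by apply: eq_bigr => t _; rewrite FE exprMn.
have [X0 X2] := centered_pair (split_mass sp) (split_mass sq) (split_X0 sp) (split_X0 sq).
have Fa : \sum_t (\sum_i a i t) ^+ 2 = 1.
  by rewrite (split_sum_sqr sp predT) (split_mass sp).
have Fb : \sum_t (\sum_i b i t) ^+ 2 = 1.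
  by rewrite (split_sum_sqr sq predT) (split_mass sq).
have [Z0 Z2] := centered_pair Fa Fb (split_Z0 sp) (split_Z0 sq).
split.
- move=> i j; transitivity
    (\sum_(t : T * V) (a i.1 t.1 * a j.1 t.1) * (b i.2 t.2 * b j.2 t.2)).
    by apply: eq_bigr => t _; rewrite mulrACA.
  rewrite (sum_pair_mul (fun t => a i.1 t * a j.1 t) (fun t => b i.2 t * b j.2 t)).
  rewrite (split_gram sp) (split_gram sq) mulrACA -natrM mulnb -xpair_eqE.
  by rewrite -!surjective_pairing.
- by rewrite sum_pair_mul (split_mass sp) (split_mass sq) mulr1.
- move=> i; under eq_bigr => t _ do rewrite normrM.
  rewrite (sum_pair_mul (fun t => `|a i.1 t|) (fun t => `|b i.2 t|)).
  by rewrite mulr_ile1 ?sumr_ge0 // ?(split_l1 sp) ?(split_l1 sq).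
- move=> i; rewrite addrACA opprD expRD.
  exact: ler_pM (expR_ge0 _) (expR_ge0 _) (split_lower sp _) (split_lower sq _).
- move=> t; rewrite FE normrM addrACA opprD expRD.
  by apply: ler_pM => //; [exact: split_upper sp _ | exact: split_upper sq _].
- exact: X0.
- by rewrite X2 (split_X2 sp) (split_X2 sq).
- by rewrite F2.
- by rewrite F2 Z2 (split_Z2 sp) (split_Z2 sq).
Qed.

End Tensor.

Lemma split_power (R : realType) (I T : finType) (a : I -> T -> R) (p X : I -> R)
    (Z : T -> R) (h e v w : R) (N : nat) :
  split_unit a p X Z h e v w ->
  exists (J V : finType) (b : J -> V -> R) (q Y : J -> R) (W : V -> R),
    split_unit b q Y W (h *+ N.+1) (e *+ N.+1) (v *+ N.+1) (w *+ N.+1).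
Proof.
move=> sp; elim: N => [|N [J [V [b [q [Y [W sq]]]]]]].
  by exists I, T, a, p, X, Z.
by do 6 eexists; rewrite ![_ *+ N.+2]mulrS; exact: split_tensor sp sq.
Qed.

(** If e > h, a deviation proportional to the number of factors makes both terms on the right of
    [split_deviation] tend to 0, against 3/4. *)
Lemma split_unit_le (R : realType) (I T : finType) (a : I -> T -> R) (p X : I -> R)
    (Z : T -> R) (h e v w : R) :
  split_unit a p X Z h e v w -> e <= h.
Proof.
move=> sp; rewrite leNgt; apply/negP => lthe.
(* With a quarter of the gap, the exponent for m factors is 2md - 4md = -2md. *)
pose d := (e - h) / 4; have d0 : 0 < d by rewrite divr_gt0 ?subr_gt0.
have v0 : 0 <= v.
  rewrite -(split_X2 sp) sumr_ge0 // => i _.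
  by rewrite mulr_ge0 ?sqr_ge0 // (split_p_ge0 sp).
have w0 : 0 <= w.
  by rewrite -(split_Z2 sp) sumr_ge0 // => i _; rewrite mulr_ge0 ?sqr_ge0.
pose K := (v + w) / d ^+ 2; have K0 : 0 <= K by rewrite divr_ge0 ?addr_ge0 ?sqr_ge0.
(* This makes m > 4K and md > 1. The two error terms are then below 1/4 and 1/3, with sum 7/12 <
   3/4. *)
pose N := Num.truncn (K *+ 4 + d^-1).
have NP : K *+ 4 + d^-1 < N.+1%:R by exact: truncnS_gt.
have [J [V [b [q [Y [W sq]]]]]] := split_power N sp.
(* An opaque copy of the number of factors, an atom for [field] and [lra]. *)
have [m mE] : {m : R | m = N.+1%:R} by exists N.+1%:R.
have m0 : 0 < m by rewrite mE ltr0n.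
have := split_deviation sq (mulr_gt0 m0 d0).
rewrite -mE in NP.
rewrite -[h *+ _]mulr_natl -[e *+ _]mulr_natl.
rewrite -[v *+ _]mulr_natl -[w *+ _]mulr_natl -mE.
have -> : (m * v + m * w) / (m * d) ^+ 2 = K / m.
  by rewrite /K; field; rewrite (gt_eqF m0) (gt_eqF d0).
have -> : m * d *+ 2 - (m * e - m * h) = - (m * d *+ 2) by rewrite /d; field.
have Km : K / m < 1 / 4.
  rewrite ltr_pdivrMr //; have := invr_gt0 d; rewrite d0; lra.
have md : 1 < m * d.
  by rewrite -ltr_pdivrMr // mul1r; lra.
have : expR (- (m * d *+ 2)) < 1 / 3.
  rewrite expRN div1r ltf_pV2 ?posrE ?expR_gt0 //.
  by apply: lt_le_trans (expR_ge1Dx _); lra.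
lra.
Qed.

(** * Orthogonality of characters and Parseval *)

Lemma chiE (R : pzRingType) n (S : {set 'I_n}) (x : {ffun 'I_n -> bool}) :
  chi R S x = (-1) ^+ odd (\sum_(i in S) x i)%N.
Proof. by rewrite /chi prodrXr signr_odd. Qed.

Lemma chi_intE (R : pzRingType) n (S : {set 'I_n}) (x : {ffun 'I_n -> bool}) :
  chi R S x = (chi int S x)%:~R.
Proof. by rewrite !chiE rmorph_sign. Qed.

Lemma chi_xor (R : pzRingType) n (S : {set 'I_n}) (x y : {ffun 'I_n -> bool}) :
  chi R S [ffun i => x i (+) y i] = chi R S x * chi R S y.
Proof. by rewrite !(chi_intE R) chiXOR rmorphM. Qed.

(** The sum over sets expands a product over coordinates, whose factors are 2 where the points agree
    and 0 where they differ. *)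
Lemma chi_sum (R : comNzRingType) n (x y : {ffun 'I_n -> bool}) :
  \sum_(S : {set 'I_n}) chi R S x * chi R S y =
  (x == y)%:R * #|{ffun 'I_n -> bool}|%:R.
Proof.
transitivity (\prod_(i < n) ((-1) ^+ (x i (+) y i) + 1 : R)).
  rewrite bigA_distr; apply: eq_bigr => S _.
  by rewrite -chi_xor /chi big_mkcond; apply: eq_bigr => i _; rewrite ffunE.
case: eqVneq => [->|/eqP xy].
  under eq_bigr => i _ do rewrite addbb.
  by rewrite prodr_const card_ffun card_bool natrX mul1r card_ord.
have [i xyi] : exists i, x i != y i.
  apply/existsP; apply: contra_notT xy; rewrite negb_exists => /forallP xy.
  by apply/ffunP => i; apply/eqP; rewrite -[_ == _]negbK.
rewrite (bigD1 i) //= (_ : x i (+) y i); last by rewrite addbC -negb_eqb eq_sym.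
by rewrite expr1 addNr !mul0r.
Qed.

Lemma parseval (R : realType) n (g h : {ffun 'I_n -> bool} -> R) :
  \sum_S fourier g S * fourier h S = cube_mean (fun x => g x * h x).
Proof.
have N0 : #|{ffun 'I_n -> bool}|%:R != 0 :> R.
  by rewrite pnatr_eq0 card_ffun card_bool expn_eq0.
rewrite /fourier /cube_mean; set N : R := _%:R in N0 *.
transitivity ((\sum_S \sum_x \sum_y (g x * h y) * (chi R S x * chi R S y)) / N ^+ 2).
  rewrite mulr_suml; apply: eq_bigr => S _; rewrite mulrACA big_distrlr /=.
  rewrite -invfM -expr2; congr (_ / _).
  by apply: eq_bigr => x _; apply: eq_bigr => y _; rewrite mulrACA.
rewrite exchange_big /=; apply: (mulIf (expf_neq0 2 N0)); rewrite divfK ?expf_neq0 //.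
rewrite expr2 mulrA divfK // mulr_suml; apply: eq_bigr => x _.
rewrite exchange_big (bigD1 x) //= -mulr_sumr chi_sum eqxx mul1r big1 ?addr0 //.
by move=> y yx; rewrite -mulr_sumr chi_sum eq_sym (negbTE yx) mul0r mulr0.
Qed.

(** * Size and Fourier coefficients of affine subspaces *)

Section Affine.
Variables (n k : nat) (C : {set {ffun 'I_n -> bool}}).
Hypothesis Ck : affine_codim k C.

(** A sign equals its cube, so sums of three points satisfy the same constraints. The nested [ffun]
    is the form that [chiXOR] rewrites. *)
Lemma affine_xor (x y z : {ffun 'I_n -> bool}) :
  x \in C -> y \in C -> z \in C ->
  [ffun i => z i (+) [ffun i => x i (+) y i] i] \in C.
Proof.
case/andP: Ck => _ /existsP[S /existsP[b /andP[_ /eqP ->]]].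
rewrite !inE => /forallP xC /forallP yC /forallP zC; apply/forallP => j.
rewrite !chiXOR (eqP (xC j)) (eqP (yC j)) (eqP (zC j)).
by case: (b j).
Qed.

(** The [k] parities cut the cube into at most 2^k fibers, and a translation embeds each nonempty
    one into [C]. *)
Lemma affine_card : (#|{ffun 'I_n -> bool}| <= 2 ^ k * #|C|)%N.
Proof.
case/andP: (Ck) => /set0Pn[x0 x0C] /existsP[S /existsP[b /andP[_ /eqP CE]]].
pose phi (x : {ffun 'I_n -> bool}) := [ffun j => odd (\sum_(i in S j) x i)%N].
rewrite -[leqLHS]sum1_card (partition_big phi predT) //=.
apply: (@leq_trans (\sum_(c : {ffun 'I_k -> bool}) #|C|)); last first.
  by rewrite sum_nat_const [X in (X * _)%N]card_ffun card_bool card_ord.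
apply: leq_sum => c _; rewrite sum1_card.
have [y /eqP yc|fib0] := pickP (fun y => phi y == c); last by rewrite eq_card0.
pose tr (z : {ffun 'I_n -> bool}) : {ffun 'I_n -> bool} := [ffun i => z i (+) [ffun i => y i (+) x0 i] i].
have tr_inj : injective tr.
  move=> z z' /ffunP zz; apply/ffunP => i; move: (zz i).
  by rewrite !ffunE => /addIb.
rewrite -(card_image tr_inj); apply/subset_leq_card/subsetP => _ /imageP[z zc ->].
move: x0C; rewrite CE !inE => /forallP x0C; apply/forallP => j.
rewrite !chiXOR (eqP (x0C j)) !chiE.
have -> : odd (\sum_(i in S j) z i)%N = odd (\sum_(i in S j) y i)%N.
  have /eqP : phi z == c by exact: zc.
  by rewrite -yc => /ffunP/(_ j); rewrite !ffunE.
by rewrite mulrA -signr_addb addbb mul1r.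
Qed.

(* Either the character S is constant on C, or translating C by the difference of
   two points where it differs shows that the coefficient vanishes; hence the
   coefficient has absolute value 0 or #|C| / 2^n. *)
Lemma fourier_affine (R : realType) (g : {ffun 'I_n -> bool} -> R) (c : R) S :
  (forall x, g x = (x \in C)%:R * c) -> c ^+ 2 = 1 ->
  fourier g S ^+ 2 = #|C|%:R / #|{ffun 'I_n -> bool}|%:R * `|fourier g S|.
Proof.
move=> gE c1.
have [/forall_inP same|] := boolP [forall x in C, forall y in C, chi R S x == chi R S y].
  have [C0|[x0 x0C]] := set_0Vmem C.
    by case/andP: Ck; rewrite C0 eqxx.
  have -> : fourier g S = #|C|%:R / #|{ffun 'I_n -> bool}|%:R * (c * chi R S x0).
    rewrite /fourier /cube_mean mulrAC; congr (_ / _).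
    rewrite -sum1_card natr_sum mulr_suml [RHS]big_mkcond /=.
    apply: eq_bigr => x _; rewrite gE; case: ifP => [xC|]; last by rewrite !mul0r.
    by rewrite -mulrA (eqP (forall_inP (same x xC) x0 x0C)).
  have cx : `|c * chi R S x0| = 1.
    apply/eqP; rewrite -(@eqrXn2 _ 2) // real_normK ?num_real // exprMn c1 chiE.
    by rewrite sqrr_sign mulr1 expr1n.
  rewrite normrM cx mulr1 exprMn -(real_normK (num_real (c * _))) cx expr1n mulr1.
  by rewrite ger0_norm ?divr_ge0 ?ler0n // expr2.
rewrite negb_forall_in => /exists_inP[x xC]; rewrite negb_forall_in => /exists_inP[y yC xy].
suff -> : fourier g S = 0 by rewrite normr0 mulr0 expr0n.
pose tr (z : {ffun 'I_n -> bool}) : {ffun 'I_n -> bool} := [ffun i => z i (+) [ffun i => x i (+) y i] i].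
have trK : involutive tr.
  by move=> z; apply/ffunP => i; rewrite !ffunE -addbA addbb addbF.
have trC z : (tr z \in C) = (z \in C).
  apply/idP/idP => zC; last exact: affine_xor.
  by rewrite -(trK z); exact: affine_xor.
have xy1 : chi R S x * chi R S y = -1.
  move: xy; rewrite !chiE; case: (odd _); case: (odd _); rewrite ?eqxx //= => _;
  by rewrite ?mulr1 ?mul1r.
have anti z : g (tr z) * chi R S (tr z) = - (g z * chi R S z).
  by rewrite !gE trC !chi_xor xy1 mulrN1 mulrN.
rewrite /fourier /cube_mean; set s := \sum_x _.
suff: s = - s by move=> ss; rewrite (_ : s = 0) ?mul0r //; lra.
rewrite {1}/s (reindex_inj (inv_inj trK)) -sumrN.
by apply: eq_bigr => z _; exact: anti.
Qed.

End Affine.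

(** * From a certificate to an orthogonal splitting *)

Section Certificate.
Variables (R : realType) (n : nat) (f : {ffun 'I_n -> bool} -> R).
Variable U : {set {set {ffun 'I_n -> bool}}}.
Hypothesis f_boolean : forall x, f x = -1 \/ f x = 1.
Hypothesis fU : parity_certificate f U.

Local Notation cube := {ffun 'I_n -> bool}.
Let N : R := #|cube|%:R.
Let C (i : 'I_#|U|) : {set cube} := enum_val i.
Let p i : R := #|C i|%:R / N.
Let g i x : R := (x \in C i)%:R * f x.
Let a i S : R := fourier (g i) S.

Let N_gt0 : 0 < N.
Proof. by rewrite ltr0n card_ffun card_bool expn_gt0. Qed.

Let f_sqr x : f x ^+ 2 = 1.
Proof. by case: (f_boolean x) => ->; rewrite ?sqrrN expr1n. Qed.

Let partU : partition U [set: cube].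
Proof. by case/andP: fU. Qed.

Let C_affine i : affine_codim (codim (C i)) (C i).
Proof.
case/andP: fU => _ /forall_inP/(_ _ (enum_valP i))/andP[/existsP[k Ck] _].
by rewrite (codimE Ck).
Qed.

Let g_const i : {c : R | c ^+ 2 = 1 & forall x, g i x = (x \in C i)%:R * c}.
Proof.
have /set0Pn/sigW[x0 x0C] : C i != set0 by case/andP: (C_affine i).
exists (f x0) => [|x]; first exact: f_sqr.
rewrite /g; case: (boolP (x \in C i)) => [xC|]; last by rewrite !mul0r.
case/andP: fU => _ /forall_inP/(_ _ (enum_valP i))/andP[_ /forall_inP/(_ _ xC)].
by move=> /forall_inP/(_ _ x0C)/eqP ->.
Qed.

Let C_trivI i j x : x \in C i -> x \in C j -> i = j.
Proof.
move=> xi xj; apply: enum_val_inj; case/and3P: partU => _ tI _.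
by rewrite -(def_pblock tI (enum_valP i) xi) -(def_pblock tI (enum_valP j) xj).
Qed.

Lemma cube_mean_certificate (s : cube -> R) :
  cube_mean s = \sum_i (\sum_(x in C i) s x) / N.
Proof.
rewrite /cube_mean -mulr_suml; congr (_ / _).
rewrite -(big_enum_val (fun B : {set cube} => \sum_(x in B) s x)) /=.
rewrite -(set_partition_big _ partU) /=.
by apply: eq_bigl => x; rewrite inE.
Qed.

Let sum_g x : \sum_i g i x = f x.
Proof.
have : x \in cover U by rewrite (cover_partition partU) inE.
case/bigcupP => B BU xB; pose i : 'I_#|U| := enum_rank_in BU B.
have xi : x \in C i by rewrite /C enum_rankK_in.
rewrite (bigD1 i) //= big1 ?addr0 /g ?xi ?mul1r // => j ji.
case: (boolP (x \in C j)) => [xj|_]; last by rewrite mul0r.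
by rewrite (C_trivI xi xj) eqxx in ji.
Qed.

Let sum_a S : \sum_i a i S = fourier f S.
Proof.
rewrite /a /fourier /cube_mean -mulr_suml exchange_big /=; congr (_ / _).
by apply: eq_bigr => x _; rewrite -mulr_suml sum_g.
Qed.

(** By Parseval this is the mean of a product of two pieces, which vanishes on disjoint blocks and
    is an indicator on equal ones, as f squares to 1. *)
Let a_gram i j : \sum_S a i S * a j S = (i == j)%:R * p i.
Proof.
rewrite parseval /cube_mean /p mulrA -(sum1_card (mem (C i))) natr_sum mulr_sumr; congr (_ / _).
rewrite [RHS]big_mkcond /=; apply: eq_bigr => x _; rewrite /g.
case: ifP => [xi|_]; last by rewrite !mul0r.
rewrite mul1r mulr1; case: (boolP (x \in C j)) => [xj|xj].
  by rewrite (C_trivI xi xj) eqxx mul1r -expr2 f_sqr.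
by case: eqVneq xj => [<-|]; rewrite ?xi // mul0r mulr0.
Qed.

Let p_gt0 i : 0 < p i.
Proof.
rewrite divr_gt0 // ltr0n card_gt0.
by case/andP: (C_affine i).
Qed.

(** By [fourier_affine], [p i] times the l1-norm is the squared l2-norm, which is again [p i]. *)
Let a_l1 i : \sum_S `|a i S| <= 1.
Proof.
have [c c1 gE] := g_const i.
rewrite -(ler_pM2l (p_gt0 i)) mulr1 mulr_sumr.
have := a_gram i i; rewrite eqxx mul1r => {2}<-; apply: ler_sum => S _.
by rewrite -(fourier_affine (C_affine i) S gE c1) expr2.
Qed.

Let p_sum1 : \sum_i p i = 1.
Proof.
transitivity (cube_mean (fun _ : cube => 1 : R)).
  rewrite cube_mean_certificate; apply: eq_bigr => i _.
  by rewrite /p -(sum1_card (mem (C i))) natr_sum.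
by rewrite /cube_mean sumr_const divff ?gt_eqF.
Qed.

Lemma certificate_aUC : \sum_i p i * (codim (C i))%:R = aUC_of R U.
Proof.
rewrite /aUC_of cube_mean_certificate; apply: eq_bigr => i _.
rewrite /p mulrAC; congr (_ / _).
rewrite -(sum1_card (mem (C i))) natr_sum mulr_suml; apply: eq_bigr => x xC; rewrite mul1r.
by case/and3P: partU => _ tI _; rewrite /UC (def_pblock tI (enum_valP i) xC).
Qed.

Let p_lower i : expR (- (ln 2 * (codim (C i))%:R)) <= p i.
Proof.
rewrite mulr_natr expRN -[ln 2 *+ _]mulr_natl expRM_natl lnK ?posrE //.
rewrite ler_pdivlMr // mulrC ler_pdivrMr ?exprn_gt0 // mulrC.
by rewrite -natrX -natrM ler_nat; exact: affine_card (C_affine i).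
Qed.

Lemma fourier_entropy_certificate : fourier_entropy f <= 2 * aUC_of R U.
Proof.
have ln2_gt0 : 0 < ln 2 :> R by rewrite ln_gt0 // ltr1n.
(* [split_lower] asks only for a lower bound on [p], so the average of [ln 2 * codim] can stand in
   for the entropy of [p]. *)
pose h : R := ln 2 * aUC_of R U.
pose e : R := \sum_S fourier f S ^+ 2 * - ln `|fourier f S|.
(* The logarithm of a square gives the factor 2 of the theorem; what remains is e <= h. *)
have -> : fourier_entropy f = 2 * e / ln 2.
  rewrite /fourier_entropy mulr_sumr mulr_suml; apply: eq_bigr => S _.
  have [->|F0] := eqVneq (fourier f S) 0; first by rewrite expr0n /= !mul0r mulr0 mul0r.
  rewrite /log2 div1r lnV ?posrE ?exprn_even_gt0 // -(real_normK (num_real _)).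
  rewrite lnXn ?normr_gt0 // mulr2n; by field; rewrite gt_eqF.
rewrite ler_pdivrMr // -mulrA ler_pM2l // [leRHS]mulrC.
have F2 : \sum_S fourier f S ^+ 2 = 1.
  transitivity (cube_mean (fun _ : cube => 1 : R)).
    by rewrite parseval; congr (_ / _); apply: eq_bigr => x _; rewrite -expr2 f_sqr.
  by rewrite /cube_mean sumr_const divff ?gt_eqF.
pose X i : R := ln 2 * (codim (C i))%:R - h.
pose Z S : R := - ln `|fourier f S| - e.
(* The variances may take any value; [reflexivity] fills them in. *)
apply: (@split_unit_le _ _ _ a p X Z h e _ _); split; try reflexivity.
- exact: a_gram.
- exact: p_sum1.
- exact: a_l1.
- by move=> i; rewrite /X addrC subrK; exact: p_lower.
- move=> S; rewrite sum_a /Z addrC subrK opprK.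
  (* At a zero coefficient [ln 0] is a default value, but any exponential is nonnegative. *)
  have [->|F0] := eqVneq (fourier f S) 0; first by rewrite normr0 expR_ge0.
  by rewrite lnK ?posrE ?normr_gt0.
- under eq_bigr => i _ do rewrite mulrBr mulrCA.
  by rewrite sumrB -mulr_sumr -mulr_suml p_sum1 certificate_aUC mul1r subrr.
- under eq_bigr => S _ do rewrite sum_a mulrBr.
  by rewrite sumrB -mulr_suml F2 mul1r subrr.
Qed.

End Certificate.

Theorem theorem1p6 (R : realType) (n : nat) (n_ge1 : (1 <= n)%N)
    (f : {ffun 'I_n -> bool} -> R)
    (f_boolean : forall x, f x = -1 \/ f x = 1) :
  fourier_entropy f <= 2 * aUC f.
Proof.
have [[U fU ->] _] := aUC_min f.
exact: fourier_entropy_certificate.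
Qed.
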